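(* Let $L$ be a Jordan subalgebra of $\mathrm{Sym}(p)$ and consider the Gaussian linear concentration model on $L$ with data $x^1,\dots,x^n$ and $W=n^{-1}\sum_ix^i(x^i)^\top$. Then $I_p\in L$, and if $\Pi_L(W)$ is invertible, the matrix $\{\Pi_L(W)\}^{-1}$ lies in $L$, it is the unique invertible solution $K\in L$ of the likelihood equation $\Pi_L(W)=\Pi_L(K^{-1})$ (so the MLE is $\hat K=\{\Pi_L(W)\}^{-1}$), and it solves the score matching equation $\Pi_L(K\circ W)=I_p$; in particular, when the score matching estimator $\check K$ exists it satisfies $\check K=\hat K=\{\Pi_L(W)\}^{-1}$.
   Context: $\mathrm{Sym}(p)$: real symmetric $p\times p$ matrices with trace inner product; $\mathrm{Sym}_+(p)$: positive definite ones; a Jordan subalgebra is a linear subspace $L$ closed under the Jordan product $A\circ B=(AB^\top+BA^\top)/2$ (equivalently $L\cap\mathrm{Sym}_+(p)$ is closed under inversion) and containing $L\cap\mathrm{Sym}_+(p)\neq\emptyset$; $\Pi_L$ is orthogonal projection onto $L$. The Gaussian linear concentration model is $\{N_p(0,K^{-1}):K\in L\cap\mathrm{Sym}_+(p)\}$; its log-likelihood is proportional to $\log\det K-\operatorname{tr}(KW)$. The score matching estimator (SME) $\check K$ is said to exist if the linear equation $\Pi_L(K\circ W)=I_p$ has a unique solution $K\in L$, which is then $\check K$ (no positive definiteness required). *)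

(* Defs.v *)
From HB Require Import structures.
From mathcomp Require Import all_boot all_order all_algebra.
Set Implicit Arguments. Unset Strict Implicit. Unset Printing Implicit Defensive.
Import Order.TTheory GRing.Theory Num.Theory.
Local Open Scope ring_scope.

Definition is_sym (R : realFieldType) (p : nat) (A : 'M[R]_p) : Prop := A^T = A.

Definition is_posdef (R : realFieldType) (p : nat) (A : 'M[R]_p) : Prop :=
  is_sym A /\ forall x : 'cV[R]_p, x != 0 -> 0 < (x^T *m A *m x) 0 0.

Definition tr_inner (R : realFieldType) (p : nat) (A B : 'M[R]_p) : R := \tr (A *m B^T).

Definition jprod (R : realFieldType) (p : nat) (A B : 'M[R]_p) : 'M[R]_p :=
  2^-1 *: (A *m B^T + B *m A^T).

Definition is_sym_subspace (R : realFieldType) (p : nat) (L : 'M[R]_p -> Prop) : Prop :=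
  [/\ L 0,
      (forall A B, L A -> L B -> L (A + B)),
      (forall (c : R) A, L A -> L (c *: A)) &
      (forall A, L A -> is_sym A)].

Definition is_jordan_subalgebra (R : realFieldType) (p : nat) (L : 'M[R]_p -> Prop) : Prop :=
  [/\ is_sym_subspace L,
      (forall A B, L A -> L B -> L (jprod A B)) &
      (exists K, L K /\ is_posdef K)].

Definition is_orth_proj (R : realFieldType) (p : nat) (L : 'M[R]_p -> Prop)
    (Pi : 'M[R]_p -> 'M[R]_p) : Prop :=
  forall A, L (Pi A) /\ (forall B, L B -> tr_inner (A - Pi A) B = 0).

Definition sample_W (R : realFieldType) (p n : nat) (x : 'I_n -> 'cV[R]_p) : 'M[R]_p :=
  (n%:R)^-1 *: \sum_(i < n) (x i *m (x i)^T).

Definition sm_solution (R : realFieldType) (p : nat) (L : 'M[R]_p -> Prop)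
    (Pi : 'M[R]_p -> 'M[R]_p) (W K : 'M[R]_p) : Prop :=
  L K /\ Pi (jprod K W) = 1%:M.

Definition SME_exists (R : realFieldType) (p : nat) (L : 'M[R]_p -> Prop)
    (Pi : 'M[R]_p -> 'M[R]_p) (W : 'M[R]_p) : Prop :=
  exists! K, sm_solution L Pi W K.

(* Main.v *)
Require Import Defs.
From HB Require Import structures.
From mathcomp Require Import all_boot all_order all_algebra.
Set Implicit Arguments. Unset Strict Implicit. Unset Printing Implicit Defensive.
Import Order.TTheory GRing.Theory Num.Theory.
Local Open Scope ring_scope.

(* Proof strategy.
   1. A Jordan subalgebra L contains every power A^k (k >= 1) of each of its
      elements, since A^(k+1) is the Jordan product of A and A^k.
   2. By Cayley-Hamilton, an invertible A satisfies c0 + sum_i c_i A^(i+1) = 0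
      with c0 = +-det A <> 0.  Hence the identity is a linear combination of
      powers of A, so I_p lies in L as soon as L contains an invertible (e.g. a
      positive definite) element; then A^-1, also a polynomial in A, lies in L.
   3. The orthogonal projection Pi onto L is characterized by orthogonality of
      the residual (definiteness of the trace inner product), so it fixes L and,
      because multiplication by A in L is self-adjoint for the Jordan product,
      Pi (A o W) = A o Pi W for A in L and W symmetric.
   4. For Khat = (Pi W)^-1 in L: Pi (Khat^-1) = Pi W, any invertible K in L with
      Pi (K^-1) = Pi W equals Khat, and Pi (Khat o W) = Khat o Pi W = I_p. *)

Section SymSubspace.
Variables (R : realFieldType) (p : nat) (L : 'M[R]_p -> Prop).
Hypothesis HL : is_sym_subspace L.

Lemma subspace0 : L 0. Proof. by case: HL. Qed.

Lemma subspaceD A B : L A -> L B -> L (A + B).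
Proof. by case: HL => _ HD _ _; apply: HD. Qed.

Lemma subspaceZ c A : L A -> L (c *: A).
Proof. by case: HL => _ _ HZ _; apply: HZ. Qed.

Lemma subspace_sym A : L A -> A^T = A.
Proof. by case: HL => _ _ _ Hs; apply: Hs. Qed.

Lemma subspaceB A B : L A -> L B -> L (A - B).
Proof. by move=> hA hB; apply: subspaceD => //; rewrite -scaleN1r; apply: subspaceZ. Qed.

Lemma subspace_sum (I : finType) (F : I -> 'M[R]_p) :
  (forall i, L (F i)) -> L (\sum_i F i).
Proof. by move=> hF; apply: big_ind => //; [exact: subspace0 | exact: subspaceD]. Qed.

Lemma subspace_lincomb (I : finType) (c : I -> R) (F : I -> 'M[R]_p) :
  (forall i, L (F i)) -> L (\sum_i c i *: F i).
Proof. by move=> hF; apply: subspace_sum => i; apply: subspaceZ. Qed.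

End SymSubspace.

Lemma jprod_symE (R : realFieldType) p (A B : 'M[R]_p) :
  A^T = A -> B^T = B -> jprod A B = 2^-1 *: (A *m B + B *m A).
Proof. by move=> hA hB; rewrite /jprod hA hB. Qed.

Lemma jprod_tr (R : realFieldType) p (A B : 'M[R]_p) : (jprod A B)^T = jprod A B.
Proof. by rewrite /jprod linearZ /= linearD /= !trmx_mul !trmxK addrC. Qed.

Lemma half_double (R : realFieldType) p (X : 'M[R]_p) : 2^-1 *: (X + X) = X.
Proof. by rewrite -mulr2n -scaler_nat scalerA mulVf ?pnatr_eq0 // scale1r. Qed.

(* Cayley-Hamilton for an invertible matrix: c0 I + sum_i c_i A^(i+1) = 0
   with a nonzero constant term c0 (the constant coefficient of char_poly A);
   for p = 0 the relation holds trivially with c0 = 1. *)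
Lemma char_poly_unit_relation (R : fieldType) p (A : 'M[R]_p) : A \in unitmx ->
  exists (c0 : R) (c : 'I_p -> R), c0 != 0 /\ c0%:M + \sum_i c i *: A ^+ i.+1 = 0.
Proof.
case: p A => [|n] A hU.
  by exists 1, (fun=> 0); split; [exact: oner_neq0 | apply/matrixP => -[]].
have CH := Cayley_Hamilton A.
rewrite -[char_poly A]coefK poly_def size_char_poly rmorph_sum big_ord_recl /= in CH.
exists (char_poly A)`_0, (fun i : 'I_n.+1 => (char_poly A)`_i.+1); split.
  by rewrite char_poly_det mulf_neq0 ?signr_eq0 // -unitfE -unitmxE.
apply: etrans CH; rewrite horner_mxZ expr0 rmorph1 scalemx1; congr (_ + _).
by apply: eq_bigr => i _; rewrite horner_mxZ rmorphXn /= horner_mx_X.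
Qed.

(* A positive definite matrix has trivial kernel, hence is invertible. *)
Lemma posdef_unit (R : realFieldType) p (K : 'M[R]_p) : is_posdef K -> K \in unitmx.
Proof.
case=> _ hpos; rewrite unitmxE unitfE; apply/negP => /det0P [v v0 vK].
have := hpos v^T; rewrite trmx_eq0 v0 trmxK => /(_ isT).
by rewrite vK mul0mx mxE ltxx.
Qed.

Section JordanSubalgebra.
Variables (R : realFieldType) (p : nat) (L : 'M[R]_p -> Prop).
Hypothesis HL : is_sym_subspace L.
Hypothesis HJ : forall A B, L A -> L B -> L (jprod A B).

(* Positive powers of an element of L stay in L: A^(k+2) = A o A^(k+1). *)
Lemma jordan_pow A k : L A -> L (A ^+ k.+1).
Proof.
move=> hA; elim: k => [|k IH]; first by rewrite expr1.
have symA := subspace_sym HL hA; have symAk := subspace_sym HL IH.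
have -> : A ^+ k.+2 = jprod A (A ^+ k.+1).
  by rewrite jprod_symE // !mulmxE -exprS -exprSr half_double.
exact: HJ.
Qed.

Lemma jordan_one A : L A -> A \in unitmx -> L 1%:M.
Proof.
move=> hA hU; have [c0 [c [c0_neq0 CH]]] := char_poly_unit_relation hU.
have hc0 : L (- c0%:M).
  have <- : \sum_i c i *: A ^+ i.+1 = - c0%:M.
    by apply/eqP; rewrite -addr_eq0 addrC CH.
  by apply: subspace_lincomb => // i; apply: jordan_pow.
have := subspaceZ HL (- c0^-1) hc0.
by rewrite scalerN scaleNr opprK scale_scalar_mx mulVf.
Qed.

Hypothesis L1 : L 1%:M.

Lemma jordan_pow0 A k : L A -> L (A ^+ k).
Proof. by case: k => [|k] hA; [rewrite expr0 | apply: jordan_pow]. Qed.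

(* L is closed under inversion: A^-1 = -c0^-1 sum_i c_i A^i. *)
Lemma jordan_inv A : L A -> A \in unitmx -> L (invmx A).
Proof.
move=> hA hU; have [c0 [c [c0_neq0 CH]]] := char_poly_unit_relation hU.
set B := \sum_i c i *: A ^+ i.
have AB : A *m B = - c0%:M.
  apply/eqP; rewrite -addr_eq0 addrC -{}CH /B mulmx_sumr; apply/eqP; congr (_ + _).
  by apply: eq_bigr => i _; rewrite -scalemxAr mulmxE exprS.
have -> : invmx A = (- c0)^-1 *: B.
  rewrite -[B]mul1mx -(mulVmx hU) -mulmxA AB mulmxN mul_mx_scalar -scaleNr.
  by rewrite scalerA mulVf ?oppr_eq0 // scale1r.
by apply: subspaceZ => //; apply: subspace_lincomb => // i; apply: jordan_pow0.
Qed.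

End JordanSubalgebra.

Section TraceInner.
Variables (R : realFieldType) (p : nat).

Lemma tr_innerB (A B C : 'M[R]_p) : tr_inner (A - B) C = tr_inner A C - tr_inner B C.
Proof. by rewrite /tr_inner mulmxBl raddfB. Qed.

Lemma tr_inner0 (C : 'M[R]_p) : tr_inner 0 C = 0.
Proof. by rewrite /tr_inner mul0mx raddf0. Qed.

(* Definiteness: <D, D> is the sum of the squares of the entries of D. *)
Lemma tr_inner_self_eq0 (D : 'M[R]_p) : tr_inner D D = 0 -> D = 0.
Proof.
have -> : tr_inner D D = \sum_i \sum_j D i j ^+ 2.
  rewrite /tr_inner /mxtrace; apply: eq_bigr => i _; rewrite mxE.
  by apply: eq_bigr => j _; rewrite mxE expr2.
move=> D0; apply/matrixP => i j; rewrite mxE; apply/eqP; rewrite -sqrf_eq0.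
have Di0 : \sum_j D i j ^+ 2 = 0.
  by apply: (psumr_eq0P _ D0) => // k _; apply: sumr_ge0 => l _; apply: sqr_ge0.
by rewrite (psumr_eq0P _ Di0) // => k _; apply: sqr_ge0.
Qed.

(* Jordan multiplication by a symmetric A is self-adjoint on symmetric
   matrices: <A o V, B> = <V, A o B>, by cyclicity of the trace. *)
Lemma jprod_adjoint (A B V : 'M[R]_p) : A^T = A -> B^T = B -> V^T = V ->
  tr_inner (jprod A V) B = tr_inner V (jprod A B).
Proof.
move=> hA hB hV; rewrite /tr_inner hB jprod_tr !jprod_symE //.
rewrite -scalemxAl -scalemxAr !linearZ /=; congr (_ * _).
rewrite mulmxDl mulmxDr !mxtraceD addrC mulmxA; congr (_ + _).
by rewrite -mulmxA mxtrace_mulC mulmxA.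
Qed.

End TraceInner.

Section Projection.
Variables (R : realFieldType) (p : nat) (L : 'M[R]_p -> Prop) (Pi : 'M[R]_p -> 'M[R]_p).
Hypothesis HL : is_sym_subspace L.
Hypothesis HP : is_orth_proj L Pi.

Lemma proj_uniq A Y : L Y -> (forall B, L B -> tr_inner (A - Y) B = 0) -> Pi A = Y.
Proof.
move=> hY hY_orth; have [hPA hPA_orth] := HP A.
apply: subr0_eq; apply: tr_inner_self_eq0.
have residuals : Pi A - Y = (A - Y) - (A - Pi A).
  by rewrite opprB [RHS]addrC addrA subrK.
have LD : L (Pi A - Y) by apply: subspaceB.
by rewrite {1}residuals tr_innerB hY_orth // hPA_orth // subrr.
Qed.

Lemma proj_id B : L B -> Pi B = B.
Proof. by move=> hB; apply: proj_uniq => // C _; rewrite subrr tr_inner0. Qed.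

Hypothesis HJ : forall A B, L A -> L B -> L (jprod A B).

Lemma proj_jprod A W : L A -> W^T = W -> Pi (jprod A W) = jprod A (Pi W).
Proof.
move=> hA hW; have [hPW hPW_orth] := HP W.
apply: proj_uniq => [|B hB]; first exact: HJ.
have symA := subspace_sym HL hA; have symB := subspace_sym HL hB.
have symPW := subspace_sym HL hPW.
rewrite tr_innerB !jprod_adjoint // -tr_innerB.
by apply: hPW_orth; apply: HJ.
Qed.

End Projection.

Lemma sample_W_sym (R : realFieldType) p n (x : 'I_n -> 'cV[R]_p) :
  (sample_W x)^T = sample_W x.
Proof.
rewrite /sample_W linearZ /= raddf_sum /=; congr (_ *: _).
by apply: eq_bigr => i _; rewrite trmx_mul trmxK.
Qed.

Theorem theorem1 (R : realFieldType) (p n : nat)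
    (L : 'M[R]_p -> Prop) (Pi : 'M[R]_p -> 'M[R]_p) (x : 'I_n -> 'cV[R]_p) :
  is_jordan_subalgebra L ->
  is_orth_proj L Pi ->
  (0 < n)%N ->
  let W := sample_W x in
  L 1%:M /\
  (Pi W \in unitmx ->
   let Khat := invmx (Pi W) in
   [/\ L Khat,
       Khat \in unitmx /\ Pi W = Pi (invmx Khat),
       (forall K, L K -> K \in unitmx -> Pi W = Pi (invmx K) -> K = Khat),
       sm_solution L Pi W Khat &
       (SME_exists L Pi W -> forall K, sm_solution L Pi W K -> K = Khat)]).
Proof.
move=> [HL HJ [K0 [LK0 pdK0]]] HP _ W.
have L1 : L 1%:M := jordan_one HL HJ LK0 (posdef_unit pdK0).
split=> // PWU Khat.
have LPW : L (Pi W) by case: (HP W).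
have LKhat : L Khat := jordan_inv HL HJ L1 LPW PWU.
have KhatU : Khat \in unitmx by rewrite unitmx_inv.
have sm_Khat : sm_solution L Pi W Khat.
  split=> //; rewrite (proj_jprod HL HP HJ LKhat (sample_W_sym x)).
  rewrite jprod_symE ?(subspace_sym HL LKhat) ?(subspace_sym HL LPW) //.
  by rewrite mulVmx ?mulmxV // half_double.
split=> //.
- by rewrite /Khat invmxK (proj_id HL HP LPW).
- move=> K LK KU; rewrite (proj_id HL HP (jordan_inv HL HJ L1 LK KU)) => PW_eq.
  by rewrite /Khat PW_eq invmxK.
- by move=> [K1 [_ uniqK1]] K smK; rewrite -(uniqK1 _ smK) (uniqK1 _ sm_Khat).
Qed.
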